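(* Let $L$ a simple connected graph on $\bar{n}$ vertices, $k\in\{1,\dots,\bar{n}-1\}$ and $c\in\mathbb{N}$. Denote by $\Delta_c^L$ the number of cliques of size $c$ in $L$, the number $\Delta_c^{\mathfrak{L}_k}$ of cliques of size $c$ in $\mathfrak{L}_k$ is given by \begin{equation} \Delta_c^{\mathfrak{L}_k} = \left(\binom{\bar{n}-c}{k-1}+\binom{\bar{n}-c}{k-(c-1)}\right)\Delta_c^L. \end{equation}
   Context: For a finite simple graph $L=(V,E)$ and $k\in\{1,\dots,|V|-1\}$, the $k$-particle graph $\mathfrak{L}_k=(\mathfrak{V}_k,\mathfrak{E}_k)$ has vertex set $\mathfrak{V}_k$ consisting of all subsets of $V$ of size $k$, and $\langle\mathfrak{v},\mathfrak{w}\rangle\in\mathfrak{E}_k$ if and only if $\mathfrak{v}\triangle\mathfrak{w}=\{v,w\}$ with $\langle v,w\rangle\in E$. The convention $\binom{\bar{n}}{z}=0$ for all negative integers $z$ is used.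
   Formalization: The formal theorem assumes c ≥ 3; the printed formula is false for c = 0, 1, 2 for every such L and k (e.g. for c = 2 it counts each edge of the k-particle graph twice). *)

(* Defs.v *)
From mathcomp Require Import all_boot all_order all_algebra.
Set Implicit Arguments.
Unset Strict Implicit.
Unset Printing Implicit Defensive.

Record sgraph := SGraph {
  vertex :> finType;
  edge : rel vertex;
  edge_sym : symmetric edge;
  edge_irrefl : irreflexive edge }.

Definition connected_graph (G : sgraph) : Prop :=
  forall x y : G, connect (@edge G) x y.

Definition is_clique (G : sgraph) (K : {set G}) : bool :=
  [forall x in K, forall y in K, (x != y) ==> edge x y].

Definition num_cliques (G : sgraph) (c : nat) : nat :=
  #|[set K : {set G} | is_clique K & #|K| == c]|.

Definition symdiff (T : finType) (A B : {set T}) : {set T} :=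
  (A :\: B) :|: (B :\: A).

Section ParticleGraph.
Variables (L : sgraph) (k : nat).

Definition particle_vertex := {A : {set L} | #|A| == k}.

Definition particle_edge (A B : particle_vertex) : bool :=
  [exists v : L, exists w : L,
     (symdiff (val A) (val B) == [set v; w]) && edge v w].

Lemma particle_edge_sym : symmetric particle_edge.
Proof. by move=> A B; rewrite /particle_edge /symdiff setUC. Qed.

Lemma particle_edge_irrefl : irreflexive particle_edge.
Proof.
move=> A; apply/existsP => -[v /existsP[w /andP[/eqP E _]]].
by have := set21 v w; rewrite -E /symdiff setDv setU0 inE.
Qed.

Definition particle_graph : sgraph :=
  SGraph particle_edge_sym particle_edge_irrefl.

End ParticleGraph.

(* Binomial coefficient with the convention that it vanishes when the lower
   index is a negative integer. *)
Definition binz (n : nat) (z : int) : nat :=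
  if z is Posz m then 'C(n, m) else 0.

(* Main.v *)
Require Import Defs.
From mathcomp Require Import all_boot all_order all_algebra.
From mathcomp Require Import zify.

(** Two adjacent [k]-sets differ by moving one particle along an edge. Given two
    members [A], [B] of a clique of k-sets, either all members contain
    [A :&: B] or all are contained in [A :|: B]. In the first case the clique
    is [{v |: S | v in K}] for a clique [K] of [L] and a [(k-1)]-set [S] disjoint
    from [K]; the second case reduces to the first, for [n - k] particles, by
    complementing every member. The two cases exclude each other as soon as
    [c >= 3], and in each of them [S] and [K] can be read off the clique as the
    intersection of its members and as the rest of their union. *)

Set Implicit Arguments.
Unset Strict Implicit.
Unset Printing Implicit Defensive.

(** * Symmetric differences of finite sets *)

Section SymmetricDifference.
Variable T : finType.
Implicit Types (A B S : {set T}) (v w : T).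

Lemma symdiff_setC A B : symdiff (~: A) (~: B) = symdiff A B.
Proof. by apply/setP => x; rewrite !inE !negbK; case: (_ \in A); case: (_ \in B). Qed.

Lemma symdiff_setU1 S v w :
  v \notin S -> w \notin S -> v != w -> symdiff (v |: S) (w |: S) = [set v; w].
Proof.
move=> vS wS vw; apply/setP => x; rewrite !inE.
have [->|xv] := eqVneq x v; first by rewrite (negbTE vS) (negbTE vw).
have [->|xw] := eqVneq x w; first by rewrite (negbTE wS).
by case: (x \in S).
Qed.

Lemma setU1_injr S : {in [set x | x \notin S] &, injective (fun v => v |: S)}.
Proof.
move=> v w; rewrite !inE => vS _ E.
by have := setU11 v S; rewrite E !inE (negbTE vS) orbF => /eqP.
Qed.

Lemma eq_set2 v w v' w' : [set v; w] = [set v'; w'] -> v != w ->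
  (v = v' /\ w = w') \/ (v = w' /\ w = v').
Proof.
move=> E; have := set21 v w; have := set22 v w; rewrite E !inE.
by do 2! case/orP => /eqP ->; rewrite ?eqxx //; tauto.
Qed.

End SymmetricDifference.

(** * Cliques of [k]-sets as families of plain sets *)

Section CliquesOfSets.
Variables (L : sgraph) (c : nat).
Implicit Types (A B C D S K : {set L}) (F : {set {set L}}) (k m : nat).

(** Adjacency on bare sets of any size: complementation turns [k]-sets into [(#|L| - k)]-sets and so
    would leave the subtype [particle_vertex L k]. *)
Definition set_edge A B : bool :=
  [exists v : L, exists w : L, (symdiff A B == [set v; w]) && edge v w].

Lemma set_edge_setC A B : set_edge (~: A) (~: B) = set_edge A B.
Proof. by rewrite /set_edge symdiff_setC. Qed.

Lemma edge_neq (v w : L) : edge v w -> v != w.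
Proof. by apply: contraTneq => ->; rewrite edge_irrefl. Qed.

Lemma set_edge_setU1 S v w : v \notin S -> w \notin S -> v != w ->
  set_edge (v |: S) (w |: S) = edge v w.
Proof.
move=> vS wS vw; apply/existsP/idP => [[v' /existsP[w']]|e].
  rewrite symdiff_setU1 // => /andP[/eqP E e].
  by have [[-> ->]|[-> ->]] := eq_set2 E vw; rewrite // edge_sym.
by exists v; apply/existsP; exists w; rewrite symdiff_setU1 // eqxx.
Qed.

Definition set_clique k F : bool :=
  [&& #|F| == c, [forall A in F, #|A| == k] &
      [forall A in F, forall B in F, (A != B) ==> set_edge A B]].

Lemma set_cliqueP k F : reflect
  [/\ #|F| = c, {in F, forall A, #|A| = k} &
      {in F &, forall A B, A != B -> set_edge A B}]
  (set_clique k F).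
Proof.
apply: (iffP and3P) => -[/eqP h1 h2 h3]; split=> //; try exact/eqP.
- by move=> A AF; apply/eqP; move/forall_inP: h2 => /(_ A AF).
- move=> A B AF BF; apply/implyP.
  by move/forall_inP: h3 => /(_ A AF)/forall_inP/(_ B BF).
- by apply/forall_inP => A AF; apply/eqP/h2.
- apply/forall_inP => A AF; apply/forall_inP => B BF; apply/implyP; exact: h3.
Qed.

(** Taking images under [val] is injective on sets of vertices, and every [set_clique] family is
    such an image because its members have size [k]. *)
Lemma num_cliques_particle k :
  num_cliques (particle_graph L k) c = #|[set F | set_clique k F]|.
Proof.
rewrite /num_cliques.
have vinj : injective (fun X : {set particle_vertex L k} => [set val A | A in X]).
  by apply: imset_inj; exact: val_inj.
rewrite -(card_imset _ vinj); congr #|pred_of_set _|; apply/setP => F.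
apply/imsetP/idP => [[X]|].
  rewrite !inE => /andP[/forall_inP cX /eqP sX] ->; apply/set_cliqueP; split.
  - by rewrite card_imset //; exact: val_inj.
  - by move=> _ /imsetP[A _ ->]; apply/eqP; exact: (valP A).
  - move=> _ _ /imsetP[A AX ->] /imsetP[B BX ->] AB.
    move/forall_inP: (cX A AX) => /(_ B BX) /implyP; apply.
    by apply: contraNneq AB => ->.
rewrite inE => /set_cliqueP[sF kF eF].
have FE : F = [set val A | A in [set A : particle_vertex L k | val A \in F]].
  apply/setP => A; apply/idP/imsetP => [AF|[B]]; last by rewrite inE => BF ->.
  have kA : #|A| == k by rewrite kF.
  by exists (exist _ A kA); rewrite ?inE.
exists [set A : particle_vertex L k | val A \in F] => //.
rewrite inE; apply/andP; split; last first.
  by rewrite -sF {2}FE card_imset //; exact: val_inj.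
apply/forall_inP => A; rewrite inE => AF; apply/forall_inP => B; rewrite inE => BF.
by apply/implyP => AB; apply: eF.
Qed.

(** Complementing both sets leaves their symmetric difference unchanged, so exchanging particles and
    holes preserves adjacency. *)
Lemma set_clique_setC k F :
  set_clique k F -> set_clique (#|L| - k) [set ~: A | A in F].
Proof.
case/set_cliqueP => sF kF eF; apply/set_cliqueP; split.
- by rewrite card_imset //; exact: setC_inj.
- by move=> _ /imsetP[A AF ->]; rewrite cardsCs setCK kF.
- move=> _ _ /imsetP[A AF ->] /imsetP[B BF ->]; rewrite set_edge_setC => AB.
  by apply: eF => //; apply: contraNneq AB => ->.
Qed.

Lemma setC_familyK F : [set ~: A | A in [set ~: A | A in F]] = F.
Proof.
rewrite -imset_comp -[RHS]imset_id; apply: eq_imset => A /=; exact: setCK.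
Qed.

Lemma setC_family_inj :
  injective (fun F : {set {set L}} => [set ~: A | A in F]).
Proof. by apply: imset_inj; exact: setC_inj. Qed.

(** * Stars and their number *)

Definition star K S : {set {set L}} := [set v |: S | v in K].

(** Disjointness is written as an inclusion in [~: p.1], so that for fixed [K] the sets [S] are the
    [m]-subsets of a known set, as [cards_draws] counts them. *)
Definition stars m : {set {set {set L}}} :=
  [set star p.1 p.2 | p : {set L} * {set L} in
     [set p : {set L} * {set L} |
       [&& is_clique p.1, #|p.1| == c, p.2 \subset ~: p.1 & #|p.2| == m]]].

Lemma starsP m F : reflect
  (exists K S, [/\ is_clique K, #|K| = c, [disjoint S & K], #|S| = m & F = star K S])
  (F \in stars m).
Proof.
apply: (iffP imsetP) => [[[K S]]|[K [S [h1 h2 h3 h4 ->]]]].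
  rewrite inE /= => /and4P[h1 /eqP h2 h3 /eqP h4] ->.
  by exists K, S; rewrite disjoints_subset.
by exists (K, S); rewrite // inE /= h1 h2 h4 !eqxx -disjoints_subset h3.
Qed.

Lemma bigcup_star K S : K != set0 -> \bigcup_(A in star K S) A = S :|: K.
Proof.
case/set0Pn => u uK; apply/setP => x; rewrite inE; apply/bigcupP/orP.
  case=> _ /imsetP[v vK ->]; rewrite !inE => /orP[/eqP ->|]; tauto.
case=> xh; first by exists (u |: S); [exact: imset_f | rewrite !inE xh orbT].
by exists (x |: S); [exact: imset_f | exact: setU11].
Qed.

Lemma bigcap_star K S : 1 < #|K| -> \bigcap_(A in star K S) A = S.
Proof.
case/card_gt1P => u [w [uK wK uw]]; apply/setP => x; apply/bigcapP/idP.
  move=> h; have := h _ (imset_f _ uK); have := h _ (imset_f _ wK).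
  rewrite !inE; case: (x \in S); rewrite ?orbT ?orbF // => /eqP -> /eqP E.
  by rewrite E eqxx in uw.
by move=> xS _ /imsetP[v _ ->]; rewrite !inE xS orbT.
Qed.

Lemma card_stars m : 1 < c ->
  #|stars m| = 'C(#|L| - c, m) * num_cliques L c.
Proof.
move=> c1; rewrite card_in_imset; last first.
  move=> [K S] [K' S']; rewrite !inE /= -!disjoints_subset.
  move=> /and4P[_ /eqP sK dK _] /and4P[_ /eqP sK' dK' _] E.
  have SS : S = S' by rewrite -(@bigcap_star K S) ?sK // E bigcap_star ?sK'.
  have K0 : K != set0 by rewrite -card_gt0 sK; lia.
  have K'0 : K' != set0 by rewrite -card_gt0 sK'; lia.
  have U : S :|: K = S :|: K' by rewrite -bigcup_star // E bigcup_star // -SS.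
  congr (_, _) => //; rewrite -SS in dK'; apply/setP => x.
  move/setP: U => /(_ x); rewrite !inE.
  case xS: (x \in S) => //= _.
  by rewrite (disjointFr dK xS) (disjointFr dK' xS).
(* Count the pairs by choosing the clique [K] first, then [S] among the [#|L| - c] remaining
   vertices. *)
rewrite -sum1_card (eq_bigl (fun p : {set L} * {set L} =>
    (p.1 \in [set K : {set L} | is_clique K & #|K| == c]) &&
    (p.2 \in [set S : {set L} | S \subset ~: p.1 & #|S| == m]))); last first.
  by move=> p; rewrite !inE -andbA.
rewrite -(pair_big_dep (fun K => K \in [set K : {set L} | is_clique K & #|K| == c])
  (fun K S => S \in [set S : {set L} | S \subset ~: K & #|S| == m])
  (fun _ _ => 1)) /=.
rewrite (eq_bigr (fun _ => 'C(#|L| - c, m))) ?sum_nat_const 1?mulnC //.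
move=> K; rewrite inE => /andP[_ /eqP sK].
by rewrite sum1_card cards_draws cardsCs setCK sK.
Qed.

Lemma stars_set_clique m F : F \in stars m -> set_clique m.+1 F.
Proof.
case/starsP => K [S [/forall_inP cK sK dSK sS ->]].
have nS v : v \in K -> v \notin S by move=> vK; rewrite (disjointFl dSK vK).
apply/set_cliqueP; split.
- rewrite card_in_imset // => v w vK wK; apply: setU1_injr; rewrite inE; exact: nS.
- by move=> _ /imsetP[v vK ->]; rewrite cardsU1 nS // sS.
- move=> _ _ /imsetP[v vK ->] /imsetP[w wK ->] vw.
  have {}vw : v != w by apply: contraNneq vw => ->.
  by rewrite set_edge_setU1 ?nS //; move/forall_inP: (cK v vK) => /(_ w wK)/implyP->.
Qed.

(** * Classification of the cliques of [k]-sets *)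

Lemma set_edge_card_setD A B :
  #|A| = #|B| -> set_edge A B -> exists a, A :\: B = [set a].
Proof.
move=> sAB /existsP[v /existsP[w /andP[/eqP E e]]].
(* Both differences have the same size since [A] and [B] do, and together they have two elements. *)
apply/cards1P; move/(congr1 (fun X : {set L} => #|X|)): E.
rewrite cards2 edge_neq // /symdiff cardsU.
have -> : (A :\: B) :&: (B :\: A) = set0.
  by apply/setP => x; rewrite !inE; case: (_ \in A); rewrite ?andbF.
have := cardsID B A; have := cardsID A B; rewrite cards0 (setIC B A); lia.
Qed.

(** Adjacency gives [A :&: B] size [m], so each member is this set plus one point; these points form
    [K]. *)
Lemma set_clique_stars m F A B : set_clique m.+1 F ->
  A \in F -> B \in F -> A != B -> {in F, forall D, A :&: B \subset D} ->
  F \in stars m.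
Proof.
case/set_cliqueP => sF kF eF AF BF AB subF; set S := A :&: B.
have sS : #|S| = m.
  have [a E] := set_edge_card_setD (etrans (kF A AF) (esym (kF B BF))) (eF A B AF BF AB).
  by have := cardsID B A; rewrite E cards1 (kF A AF) -/S; lia.
pose K := [set v | v \notin S & v |: S \in F].
have FE : F = star K S.
  apply/setP => D; apply/idP/imsetP => [DF|[v]]; last by rewrite inE => /andP[_ h] ->.
  have /cards1P[v E] : #|D :\: S| == 1.
    by have := cardsID S D; rewrite (setIidPr (subF D DF)) (kF D DF) -/S sS; lia.
  have DE : D = v |: S.
    by rewrite -E setUC -{1}(setID D S) (setIidPr (subF D DF)).
  exists v => //; rewrite inE -DE DF andbT.
  by have := set11 v; rewrite -E inE => /andP[].
have nS v : v \in K -> v \notin S by rewrite inE => /andP[].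
apply/starsP; exists K, S; split=> //.
- apply/forall_inP => v vK; apply/forall_inP => w wK; apply/implyP => vw.
  rewrite -(set_edge_setU1 (nS v vK) (nS w wK) vw); apply: eF.
  + by move: vK; rewrite inE => /andP[].
  + by move: wK; rewrite inE => /andP[].
  + apply: contraNneq vw => vwS; apply/eqP; apply: setU1_injr vwS.
      by rewrite in_set nS.
    by rewrite in_set nS.
- rewrite -sF FE card_in_imset // => v w vK wK; apply: setU1_injr; rewrite inE; exact: nS.
- by rewrite disjoint_sym disjoints_subset; apply/subsetP => v /nS; rewrite in_setC.
Qed.

Lemma set_clique_dichotomy k F A B : set_clique k F ->
  A \in F -> B \in F -> A != B ->
  {in F, forall D, A :&: B \subset D} \/ {in F, forall D, D \subset A :|: B}.
Proof.
case/set_cliqueP => _ kF eF AF BF AB.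
have [/forall_inP|] := boolP [forall D in F, A :&: B \subset D]; first by left.
case/forall_inPn => C CF /subsetPn[s]; rewrite inE => /andP[sA sB] sC.
have [/forall_inP|] := boolP [forall D in F, D \subset A :|: B]; first by right.
case/forall_inPn => D DF /subsetPn[x xD]; rewrite inE negb_or => /andP[xA xB].
exfalso.
(* Differences of members have at most one point. This forces [b] into [C] and [a] into [D], and
   then [D :\: B] contains both [x] and [a], although only [a] lies in [A]. *)
have one X Y y z : X \in F -> Y \in F ->
    y \in X -> y \notin Y -> z \in X -> z \notin Y -> y = z.
  move=> XF YF yX yY zX zY.
  have XY : X != Y by apply: contraNneq yY => <-.
  have [u E] := set_edge_card_setD (etrans (kF X XF) (esym (kF Y YF))) (eF X Y XF YF XY).
  have := in_set1 y u; have := in_set1 z u; rewrite -E !inE yX yY zX zY.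
  by move=> /esym/eqP -> /esym/eqP ->.
have [a E] := set_edge_card_setD (etrans (kF A AF) (esym (kF B BF))) (eF A B AF BF AB).
have BA : B != A by rewrite eq_sym.
have [b E'] := set_edge_card_setD (etrans (kF B BF) (esym (kF A AF))) (eF B A BF AF BA).
have := set11 a; rewrite -E inE => /andP[aB aA].
have := set11 b; rewrite -E' inE => /andP[bA bB].
have bC : b \in C.
  by apply: contraNT bA => bC; rewrite (one B C b s).
have xC : x \notin C.
  by apply: contra xB => xC; rewrite (one C A x b).
have sD : s \notin D.
  by apply: contraL sA => sD; rewrite (one D C s x).
have aD : a \in D.
  by apply: contraNT aB => aD; rewrite (one A D a s).
by move: xA; rewrite (one D B x a) ?aA.
Qed.

(** The members of a star have a union of size [m + c], while those of a complemented star all lie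
    in [~: S'], of size [m + 2]. *)
Lemma stars_setC_disjoint m m' : 2 < c -> m + m' + 2 = #|L| ->
  [disjoint stars m & [set [set ~: A | A in F] | F : {set {set L}} in stars m']].
Proof.
move=> c2 mL; rewrite -setI_eq0; apply/eqP/setP => F; rewrite in_set0.
apply/negbTE/negP; rewrite inE => /andP[/starsP[K [S [_ sK dSK sS FE]]]].
case/imsetP => _ /starsP[K' [S' [_ _ _ sS' ->]]] FE'.
have : S :|: K \subset ~: S'.
  rewrite -bigcup_star -?card_gt0 ?sK; last by lia.
  rewrite -FE FE'; apply/bigcupsP => _ /imsetP[_ /imsetP[v _ ->] ->].
  by rewrite setCS subsetUr.
move/subset_leq_card; rewrite cardsU (disjoint_setI0 dSK) cards0 sS sK.
by have := cardsC S'; rewrite sS'; lia.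
Qed.

Lemma set_cliques_stars m m' : 1 < c -> m + m' + 2 = #|L| ->
  [set F | set_clique m.+1 F] =
  stars m :|: [set [set ~: A | A in F] | F : {set {set L}} in stars m'].
Proof.
move=> c1 mL; have kC : #|L| - m.+1 = m'.+1 by lia.
have kC' : #|L| - m'.+1 = m.+1 by lia.
apply/setP => F; rewrite !inE; apply/idP/orP => [cF|[]]; last first.
- by case/imsetP => G /stars_set_clique/set_clique_setC; rewrite kC' => h ->.
- exact: stars_set_clique.
have /card_gt1P[A [B [AF BF AB]]] : 1 < #|F| by case/set_cliqueP: cF => ->.
have [sub|sub] := set_clique_dichotomy cF AF BF AB.
  by left; apply: set_clique_stars sub.
right; apply/imsetP; exists [set ~: A | A in F]; last by rewrite setC_familyK.
(* By De Morgan, lying below [A :|: B] becomes containing [~: A :&: ~: B]. *)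
apply: (@set_clique_stars _ _ (~: A) (~: B)); rewrite ?imset_f //.
- by rewrite -kC; exact: set_clique_setC.
- by apply: contraNneq AB => /setC_inj ->.
- by move=> _ /imsetP[D DF ->]; rewrite -setCU setCS sub.
Qed.

End CliquesOfSets.

(** * The final count *)

Lemma num_cliques_gt_card (G : sgraph) c : #|G| < c -> num_cliques G c = 0.
Proof.
move=> Gc; apply/eqP; rewrite cards_eq0; apply/eqP/setP => K; rewrite !inE.
by rewrite [#|K| == c]ltn_eqF ?andbF // (leq_ltn_trans (max_card _) Gc).
Qed.

Theorem theorem3p5 (L : sgraph) (n k c : nat)
    (hn : #|L| = n) (hL : connected_graph L)
    (hk : 1 <= k <= n - 1) (hc : 3 <= c) :
  num_cliques (particle_graph L k) c =
    (binz (n - c) (k%:Z - 1)%R + binz (n - c) (k%:Z - (c%:Z - 1))%R)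
      * num_cliques L c.
Proof.
case: k hk => [|m] hk; first by lia.
have mL : m + (n - m.+2) + 2 = #|L| by rewrite hn; lia.
have c1 : 1 < c by lia.
rewrite num_cliques_particle (set_cliques_stars c1 mL) cardsU.
rewrite (disjoint_setI0 (stars_setC_disjoint hc mL)) cards0 subn0.
rewrite (card_imset _ (@setC_family_inj L)) !card_stars // hn -mulnDl.
(* For [n < c] the subtraction [n - c] truncates to 0, but [L] has no clique of size [c], so both
   sides vanish. *)
have [nc|cn] := ltnP n c.
  by rewrite num_cliques_gt_card ?hn // !muln0.
congr ((_ + _) * _).
  by have -> : (m.+1%:Z - 1)%R = m%:Z%R by lia.
(* Here [m.+2] is [k + 1]. If it is below [c], the integer index is negative and [n - m.+2] exceeds
   [n - c], so both coefficients are 0; otherwise they agree by the symmetry of binomial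
   coefficients. *)
have [mc|cm] := ltnP m.+2 c.
  rewrite bin_small; last by lia.
  case E: (m.+1%:Z - (c%:Z - 1))%R => [z|z] //; lia.
have -> : (m.+1%:Z - (c%:Z - 1))%R = (m.+2 - c)%N%:Z%R by lia.
rewrite /= -bin_sub; last by lia.
by congr 'C(_, _); lia.
Qed.
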